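(* Let $\Gamma$ be a finitely generated, residually finite group with finite generating set $X$. Then for every positive integer $n$, $$\log(\mathrm{G}_{\Gamma,X}(n))\le \mathrm{s}_\Gamma(\mathrm{F}_{\Gamma,X}(2n))\,\log(\mathrm{F}_{\Gamma,X}(2n)).$$
   Context: $\|\cdot\|_X$ denotes word length with respect to $X$ and $B_{\Gamma,X}(n)=\{\gamma\in\Gamma:\|\gamma\|_X\le n\}$. $\mathrm{G}_{\Gamma,X}(n)$ is the cardinality of the smallest finite group $Q$ for which there exists a surjective homomorphism $\varphi:\Gamma\to Q$ whose restriction to $B_{\Gamma,X}(n)$ is injective. $\mathrm{s}_\Gamma(n)$ is the number of normal subgroups $\Delta\lhd\Gamma$ with $[\Gamma:\Delta]\le n$. $\mathrm{F}_{\Gamma,X}(n)$ is the smallest positive integer $N$ such that for every nontrivial $\gamma\in\Gamma$ with $\|\gamma\|_X\le n$ there is a normal subgroup of $\Gamma$ of finite index at most $N$ not containing $\gamma$. *)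

(* Defs.v *)
From HB Require Import structures.
From mathcomp Require Import all_boot all_order all_algebra all_fingroup.
From mathcomp Require Import finmap.
From mathcomp Require Import all_classical all_reals all_analysis.

Set Implicit Arguments.
Unset Strict Implicit.
Unset Printing Implicit Defensive.

Import Order.TTheory GRing.Theory Num.Theory.

Local Open Scope classical_set_scope.
Local Open Scope group_scope.

(* Arbitrary, possibly infinite, groups are taken as [groupType]; subgroups are
   classical sets. *)

(* Least element of [A], with default value 0 when [A] is empty. *)
Definition nat_min (A : set nat) : nat :=
  xget 0%N [set m | A m /\ forall k, A k -> (m <= k)%N].

Lemma nat_minP (A : set nat) :
  A !=set0 -> A (nat_min A) /\ forall k, A k -> (nat_min A <= k)%N.
Proof.
move=> [a Aa].
have exA : exists k, `[< A k >] by exists a; apply/asboolP.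
apply: (@xgetPex _ 0%N [set m | A m /\ forall k, A k -> (m <= k)%N]).
exists (ex_minn exA); case: ex_minnP => m /asboolP Am min_m.
by split=> // k Ak; apply: min_m; apply/asboolP.
Qed.

Section GroupDefs.
Variable G : groupType.
Implicit Types (X D H : set G) (g : G) (n : nat).

Definition is_subgroup H : Prop := group_closed (mem H).

Definition is_normal_subgroup D : Prop :=
  is_subgroup D /\ forall x g, D x -> D (x ^ g).

Definition left_cosets D : set (set G) :=
  [set [set x * d | d in D] | x in [set: G]].

Definition finite_index D : Prop := finite_set (left_cosets D).

(* The value is 0 when the index is infinite. *)
Definition subgroup_index D : nat := #|` fset_set (left_cosets D)|.

Definition normal_index_le n : set (set G) :=
  [set D | [/\ is_normal_subgroup D, finite_index D & (subgroup_index D <= n)%N]].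

Definition residually_finite : Prop :=
  forall g, g <> 1 ->
    exists D, [/\ is_normal_subgroup D, finite_index D & ~ D g].

Definition generated_subgroup X : set G :=
  \bigcap_(H in [set H | is_subgroup H /\ X `<=` H]) H.

Definition generates X : Prop := generated_subgroup X = setT.

Definition is_word X (w : seq G) : Prop :=
  forall x, x \in w -> X x \/ X x^-1.

Definition word_length X g : nat :=
  nat_min [set size w | w in [set w | is_word X w /\ \prod_(x <- w) x = g]].

Definition word_ball X n : set G := [set g | (word_length X g <= n)%N].

Definition residual_girth X n : nat :=
  nat_min [set m | exists (Q : finGroupType) (phi : {multiplicative G -> Q}),
    [/\ m = #|Q|, range phi = setT & set_inj (word_ball X n) phi]].

(* The value is 0 when there are infinitely many such subgroups, which does not
   happen for a finitely generated group. *)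
Definition normal_subgroup_growth n : nat :=
  #|` fset_set (normal_index_le n)|.

Definition residual_finiteness_growth X n : nat :=
  nat_min [set N | (0 < N)%N /\
    forall g, g <> 1 -> (word_length X g <= n)%N ->
      exists2 D, normal_index_le N D & ~ D g].

End GroupDefs.

Arguments residually_finite : clear implicits.
Arguments normal_subgroup_growth : clear implicits.

(* Main.v *)
(** Let N = F(2n). A finitely generated group has only finitely many normal
    subgroups of index at most N, namely s(N) of them. Recording the coset of an
    element modulo each of them maps Gamma to a set of size at most N ^ s(N), and
    the fibres of this map are the classes of a group congruence. Two distinct
    elements x, y of the n-ball are separated because x^-1 y lies in the 2n-ball,
    hence outside one of these subgroups. *)

Require Import Defs.
From HB Require Import structures.
From mathcomp Require Import all_boot all_order all_algebra all_fingroup.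
From mathcomp Require Import finmap.
From mathcomp Require Import all_classical all_reals all_analysis.

Set Implicit Arguments.
Unset Strict Implicit.
Unset Printing Implicit Defensive.

Import Order.TTheory GRing.Theory Num.Theory.

Local Open Scope classical_set_scope.
Local Open Scope ring_scope.

(** The image of [f] is the carrier of [Q], which bounds its order. Products and inverses are
    computed on chosen preimages, and compatibility of [f] with products makes the choice
    irrelevant. *)
Lemma finite_congruence_quotient (G : groupType) (T : finType) (f : G -> T) :
    (forall x x' y y', f x = f x' -> f y = f y' -> f (x * y)%g = f (x' * y')%g) ->
  exists (Q : finGroupType) (phi : {multiplicative G -> Q}),
    [/\ (#|Q| <= #|T|)%N, range phi = setT &
        forall x y, phi x = phi y -> f x = f y].
Proof.
move=> fM.
pose U := {t : T | `[< range f t >]}.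
have fU x : `[< range f (f x) >] by apply/asboolP; exists x.
pose q x : U := exist _ (f x) (fU x).
have qE x y : f x = f y -> q x = q y by move=> ?; apply/val_inj.
have repr_exists (u : U) : exists x, q x = u.
  by case: u => t /[dup] /asboolP[x _ <-] ?; exists x; apply/val_inj.
have [r rK] := choice repr_exists.
(* The only fact about the choice [r] that the group laws need: [fM] then lets [r (q x)] be replaced
   by [x] inside any product. *)
have frq x : f (r (q x)) = f x := congr1 val (rK (q x)).
pose mul (u v : U) := q (r u * r v)%g.
pose inv (u : U) := q (r u)^-1%g.
have mulA : associative mul.
  move=> u v w; apply: qE.
  transitivity (f (r u * (r v * r w)))%g; first by apply: fM; rewrite ?frq.
  by rewrite mulgA; apply: fM; rewrite ?frq.
have mul1 : left_id (q 1%g) mul.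
  by move=> u; rewrite -[RHS]rK; apply: qE; rewrite -[X in _ = f X]mul1g; apply: fM; rewrite ?frq.
have mulV : left_inverse (q 1%g) inv mul.
  by move=> u; apply: qE; rewrite -(mulVg (r u)); apply: fM; rewrite ?frq.
pose Q : finGroupType := HB.pack U (Finite_isGroup.Build U mulA mul1 mulV).
have qM : {morph (q : G -> Q) : x y / (x * y)%g}.
  by move=> x y; apply: qE; apply: fM; rewrite frq.
pose phi : {multiplicative G -> Q} :=
  HB.pack (q : G -> Q) (isMultiplicative.Build G Q q qM).
exists Q, phi; split.
- by rewrite card_sig max_card.
- by apply/seteqP; split=> // u _; exists (r u) => //; apply: rK.
- by move=> x y /(congr1 val).
Qed.

Lemma subgroup_closed (G : groupType) (H : set G) :
  is_subgroup H ->
  [/\ H 1%g, forall x y, H x -> H y -> H (x * y)%g & forall x, H x -> H x^-1%g].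
Proof.
move=> HG; have [H1 _] := HG; split.
- by move: H1; rewrite inE.
- move=> x y Hx Hy; have := group_closedM HG.
  by move=> /(_ x y); rewrite !inE; apply.
- by move=> x Hx; have := group_closedV HG => /(_ x); rewrite !inE; apply.
Qed.

Lemma eq_left_coset (G : groupType) (D : set G) (x y : G) :
  is_subgroup D ->
  [set x * d | d in D]%g = [set y * d | d in D]%g <-> D (x^-1 * y)%g.
Proof.
move=> /subgroup_closed[D1 DM DV]; split=> [Exy|Dxy].
  have : [set y * d | d in D]%g y by exists 1%g; rewrite ?mulg1.
  by rewrite -Exy => -[d Dd <-]; rewrite mulKg.
apply/seteqP; split=> _ [d Dd <-].
  exists ((x^-1 * y)^-1 * d)%g; first by apply: DM => //; apply: DV.
  by rewrite invgM invgK !mulgA mulgV mul1g.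
by exists (x^-1 * y * d)%g; [exact: DM | rewrite !mulgA mulgV mul1g].
Qed.

(** The colour of [x] is the position of its coset in the enumeration of all cosets; the index bound
    makes it fit in ['I_N]. *)
Lemma coset_coloring (G : groupType) (N : nat) (D : set G) :
  normal_index_le N D ->
  exists c : G -> 'I_N, forall x y, c x = c y <-> D (x^-1 * y)%g.
Proof.
move=> [[sD _] fD leDN].
pose C := fset_set (left_cosets D).
have inC x : [set x * d | d in D]%g \in C.
  by rewrite in_fset_set // inE; exists x.
have ltN x : (index [set x * d | d in D]%g (enum_fset C) < N)%N.
  by apply: leq_trans leDN; rewrite index_mem; apply: inC.
exists (fun x => Ordinal (ltN x)) => x y; rewrite -(eq_left_coset x y sD).
split=> [/(congr1 val)/= Exy|Exy]; last by apply/val_inj; rewrite /= Exy.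
by rewrite -[LHS](nth_index set0 (inC x)) Exy nth_index //; apply: inC.
Qed.

(** Normality enters here: moving [x^-1 * x'] past [y] conjugates it by [y], which keeps it in
    [D]. *)
Lemma coset_coloringM (G : groupType) (T : Type) (D : set G) (c : G -> T) :
    is_normal_subgroup D -> (forall x y, c x = c y <-> D (x^-1 * y)%g) ->
  forall x x' y y', c x = c x' -> c y = c y' -> c (x * y)%g = c (x' * y')%g.
Proof.
move=> [/subgroup_closed[_ DM _] DJ] cP x x' y y' /cP Dx /cP Dy; apply/cP.
suff -> : ((x * y)^-1 * (x' * y') = ((x^-1 * x') ^ y) * (y^-1 * y'))%g.
  by apply: DM => //; apply: DJ.
by rewrite conjgE invgM !mulgA mulgK.
Qed.

Lemma is_word_cat (G : groupType) (X : set G) (v w : seq G) :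
  is_word X v -> is_word X w -> is_word X (v ++ w).
Proof. by move=> Xv Xw x; rewrite mem_cat => /orP[/Xv|/Xw]. Qed.

Lemma word_inv (G : groupType) (X : set G) (w : seq G) :
  is_word X w ->
  exists v, [/\ is_word X v, size v = size w &
                (\prod_(x <- v) x = (\prod_(x <- w) x)^-1)%g].
Proof.
elim: w => [|x w IHw] Xw; first by exists [::]; rewrite !big_nil invg1.
have [|v [Xv sv pv]] := IHw; first by move=> y yw; apply: Xw; rewrite inE yw orbT.
exists (v ++ [:: x^-1%g]); split.
- apply: is_word_cat => // y; rewrite inE => /eqP->; rewrite invgK.
  by apply/or_comm/Xw; rewrite mem_head.
- by rewrite size_cat addn1 sv.
- by rewrite big_cat big_seq1 big_cons invgM pv.
Qed.

(** The values of words form a subgroup containing [X], so this subgroup contains the intersection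
    defining [generated_subgroup X]. *)
Lemma generates_word (G : groupType) (X : set G) (g : G) :
  generates X -> exists2 w, is_word X w & (\prod_(x <- w) x)%g = g.
Proof.
move=> genX; pose H : set G :=
  [set h | exists2 w, is_word X w & (\prod_(x <- w) x)%g = h].
suff : generated_subgroup X `<=` H by rewrite genX; apply.
move=> h; apply; split=> [|x Xx]; last first.
  by exists [:: x]; rewrite ?big_seq1 // => y; rewrite inE => /eqP->; left.
split; first by rewrite inE; exists [::]; rewrite ?big_nil.
(* Closure is tested on quotients [x / y], hence the inverted second word. *)
move=> x y; rewrite !inE => -[v Xv <-] [w /word_inv[w' [Xw' _ pw']] <-].
by exists (v ++ w'); [exact: is_word_cat | rewrite big_cat pw'].
Qed.

(** Generation makes the set of lengths nonempty, so [nat_min] is attained and is not its default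
    0. *)
Lemma word_lengthP (G : groupType) (X : set G) (g : G) :
  generates X ->
  exists w, [/\ is_word X w, (\prod_(x <- w) x)%g = g & size w = word_length X g].
Proof.
move=> genX; have [w Xw pw] := generates_word g genX.
have [|[v [Xv pv] sv] _] := @nat_minP
  [set size w | w in [set w | is_word X w /\ (\prod_(x <- w) x)%g = g]].
  by exists (size w), w.
by exists v.
Qed.

Lemma word_length_le (G : groupType) (X : set G) (w : seq G) :
  is_word X w -> (word_length X (\prod_(x <- w) x)%g <= size w)%N.
Proof.
move=> Xw; pose g := (\prod_(x <- w) x)%g.
have [|_] := @nat_minP
  [set size w | w in [set w | is_word X w /\ (\prod_(x <- w) x)%g = g]].
  by exists (size w), w.
by apply; exists w.
Qed.

Lemma word_length_divl (G : groupType) (X : set G) (x y : G) :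
  generates X ->
  (word_length X (x^-1 * y)%g <= word_length X x + word_length X y)%N.
Proof.
move=> genX; have [v [/word_inv[v' [Xv' sv' pv']] <- <-]] := word_lengthP x genX.
have [w [Xw <- <-]] := word_lengthP y genX.
rewrite -pv' -sv' -size_cat -big_cat; apply: word_length_le.
exact: is_word_cat.
Qed.

(** Packing generators and their inverses into one finite type turns words into sequences over [A],
    so that words of bounded length and tables indexed by letters form finite types. *)
Lemma finite_alphabet (G : groupType) (X : set G) :
  finite_set X ->
  exists (A : finType) (v : A -> G),
    forall w, is_word X w -> exists s, w = map v s.
Proof.
move=> finX; pose Y := fset_set (X `|` [set x^-1%g | x in X]).
exists Y, val; elim=> [|x w IHw] Xxw; first by exists [::].
have [|s ->] := IHw; first by move=> y yw; apply: Xxw; rewrite inE yw orbT.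
have Yx : x \in Y.
  rewrite in_fset_set ?finite_setU; last by split=> //; apply: finite_image.
  rewrite inE; case: (Xxw x (mem_head _ _)) => [|Xx]; first by left.
  by right; exists x^-1%g; rewrite ?invgK.
by exists ([` Yx]%fset :: s).
Qed.

Lemma finite_word_ball (G : groupType) (X : set G) (n : nat) :
  finite_set X -> generates X -> finite_set (word_ball X n).
Proof.
move=> /finite_alphabet[A [v vP]] genX.
pose f (s : n.-bseq A) := (\prod_(a <- s) v a)%g.
apply: (@sub_finite_set _ _ [set f s | s in [set: n.-bseq A]]).
  move=> g; rewrite /word_ball /=.
  have [w [/vP[s ->] <- <-]] := word_lengthP g genX; rewrite size_map => les.
  by exists (Bseq les) => //; rewrite /f /= big_map.
exact/finite_image/finite_finset.
Qed.

(* A finite-index subgroup is recovered from the action of the generators on its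
   numbered cosets, and there are finitely many such tables. *)
Lemma finite_normal_index_le (G : groupType) (X : set G) (N : nat) :
  finite_set X -> generates X -> finite_set (@normal_index_le G N).
Proof.
move=> /finite_alphabet[A [v vP]] genX.
(* A table consists of the colour of the base coset and a transition map. Letters act by left
   multiplication, so a word is read from its right end. *)
pose run (t : 'I_N * {ffun A * 'I_N -> 'I_N}) s :=
  foldr (fun a i => t.2 (a, i)) t.1 s.
pose stab t := [set g | exists2 s, (\prod_(a <- s) v a)%g = g & run t s = t.1].
apply: (@sub_finite_set _ _ (range stab)); last exact/finite_image/finite_finset.
move=> D ND; have [c cP] := coset_coloring ND; have [nD _ _] := ND.
have cM := coset_coloringM nD cP.
(* A colour carried by no element may be sent anywhere; it is left fixed. *)
have step (p : A * 'I_N) : exists j, forall y, c y = p.2 -> c (v p.1 * y)%g = j.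
  have [[y cy]|noy] := pselect (exists y, c y = p.2).
    by exists (c (v p.1 * y)%g) => z cz; apply: cM => //; rewrite cz.
  by exists p.2 => y cy; case: noy; exists y.
have [act actP] := choice step.
pose t := (c 1%g, [ffun p => act p]).
have runE s : run t s = c (\prod_(a <- s) v a)%g.
  elim: s => [|a s IHs]; first by rewrite big_nil.
  by rewrite big_cons (actP (a, run t s)) ?IHs // [LHS]/= ffunE -IHs.
have c1E g : c g = c 1%g <-> D g.
  by have := cP 1%g g; rewrite invg1 mul1g => <-; split=> /esym.
exists t => //; apply/seteqP; split=> [g [s <-]|g /c1E Dg].
  by rewrite runE => /c1E.
have [w /vP[s ->] pw] := generates_word g genX.
by rewrite big_map in pw; exists s; rewrite // runE pw.
Qed.

(** The ball is finite, so one bound serves all its nontrivial elements; hence the minimum is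
    attained. *)
Lemma residual_finiteness_growthP (G : groupType) (X : set G) (n : nat) :
  residually_finite G -> finite_set X -> generates X ->
  (0 < residual_finiteness_growth X n)%N /\
  forall g, g <> 1%g -> (word_length X g <= n)%N ->
    exists2 D, normal_index_le (residual_finiteness_growth X n) D & ~ D g.
Proof.
move=> rfG finX genX.
have /finite_seqP[s sE] := finite_word_ball n finX genX.
have sep (g : G) : exists D : set G, g <> 1%g ->
    [/\ is_normal_subgroup D, finite_index D & ~ D g].
  (* The value at 1 is a dummy: it can only enlarge the maximum below. *)
  have [->|/rfG[D DP]] := pselect (g = 1%g); first by exists set0.
  by exists D.
have [K KP] := choice sep.
(* The successor guarantees positivity. *)
pose N := (\max_(g <- s) subgroup_index (K g)).+1.
have [|] := @nat_minP [set N | (0 < N)%N /\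
    forall g, g <> 1%g -> (word_length X g <= n)%N ->
      exists2 D, @normal_index_le G N D & ~ D g]; last by [].
exists N; split=> // g g1 leg; have [nK fK Kg] := KP g g1.
exists (K g) => //; split=> //; apply: leqW.
have gs : g \in s by have : word_ball X n g := leg; rewrite sE.
exact: (leq_bigmax_seq (F := fun h => subgroup_index (K h)) g gs isT).
Qed.

Lemma residual_girth_le (G : groupType) (X : set G) (n N : nat) :
    finite_set X -> generates X ->
    (forall g, g <> 1%g -> (word_length X g <= 2 * n)%N ->
       exists2 D, @normal_index_le G N D & ~ D g) ->
  (0 < residual_girth X n <= N ^ normal_subgroup_growth G N)%N.
Proof.
move=> finX genX sep.
have finS := finite_normal_index_le N finX genX.
pose S := fset_set (@normal_index_le G N).
have inS D : (D \in S) = (D \in @normal_index_le G N) by rewrite in_fset_set.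
have SP (D : S) : normal_index_le N (val D).
  by have := valP D; rewrite inS inE.
have [c cP] := choice (fun D => coset_coloring (SP D)).
pose f x := [ffun D : S => c D x].
have fM x x' y y' : f x = f x' -> f y = f y' -> f (x * y)%g = f (x' * y')%g.
  move=> /ffunP fx /ffunP fy; apply/ffunP => D; rewrite !ffunE.
  have [nD _ _] := SP D; apply: (coset_coloringM nD (cP D)).
    by have := fx D; rewrite !ffunE.
  by have := fy D; rewrite !ffunE.
have [Q [phi [leQ phi_surj phi_f]]] := finite_congruence_quotient fM.
have phi_inj : set_inj (word_ball X n) phi.
  move=> x y; rewrite !inE => Bx By /phi_f fxy; apply: contrapT => xy.
  have [||D ND] := sep (x^-1 * y)%g.
  - by move=> E; apply: xy; rewrite -[LHS]mulg1 -E mulgA mulgV mul1g.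
  - by rewrite (leq_trans (word_length_divl _ _ genX)) // mul2n -addnn leq_add.
  - have DS : D \in S by rewrite inS inE.
    case; apply/(cP [` DS]%fset); have /ffunP/(_ [` DS]%fset) := fxy.
    by rewrite !ffunE.
(* The quotient [Q] shows that the minimum is attained; being the order of a group, it is
   positive. *)
have [|[Q' [_ [girthE _ _]]] leg] := @nat_minP
  [set m | exists (Q : finGroupType) (phi : {multiplicative G -> Q}),
    [/\ m = #|Q|, range phi = setT & set_inj (word_ball X n) phi]].
  by exists #|Q|, Q, phi.
apply/andP; split.
  by rewrite /residual_girth girthE; apply/card_gt0P; exists 1%g.
apply: leq_trans (leg #|Q| _) _; first by exists Q, phi.
by rewrite (leq_trans leQ) // card_ffun card_ord -cardfE.
Qed.

Theorem mainTheorem10 (R : realType) (Gamma : groupType) (X : set Gamma)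
    (Gamma_residually_finite : residually_finite Gamma)
    (X_finite : finite_set X) (X_generates : generates X)
    (n : nat) (n_gt0 : (0 < n)%N) :
  ln ((residual_girth X n)%:R : R) <=
    (normal_subgroup_growth Gamma
       (residual_finiteness_growth X (2 * n)))%:R *
    ln ((residual_finiteness_growth X (2 * n))%:R : R).
Proof.
have [F_gt0 sep] := residual_finiteness_growthP (2 * n)
  Gamma_residually_finite X_finite X_generates.
have /andP[g_gt0 leg] := residual_girth_le X_finite X_generates sep.
(* The right side becomes the logarithm of a power; comparing arguments requires both to be
   positive. *)
rewrite mulr_natl -lnXn ?ltr0n // -natrX ler_ln ?posrE ?ltr0n ?expn_gt0 ?F_gt0 //.
by rewrite ler_nat.
Qed.
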